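(* Let $A$ be a locally $C^*$-algebra and let $E$ and $F$ be two Hilbert $A$-modules. Then $E$ and $F$ are unitarily equivalent (as Hilbert $A$-modules) if and only if $M(E)$ and $M(F)$ are unitarily equivalent (as Hilbert $M(A)$-modules).
   Context: A locally $C^*$-algebra is a complete Hausdorff complex topological $*$-algebra $A$ whose topology is determined by its continuous $C^*$-seminorms; $S(A)$ is the set of all continuous $C^*$-seminorms on $A$. A pre-Hilbert $A$-module is a complex vector space $E$ which is a right $A$-module (compatibly with the complex algebra structure), with an $A$-valued inner product $\langle\cdot,\cdot\rangle:E\times E\to A$ which is $\mathbb C$- and $A$-linear in the second variable, with $\langle\xi,\eta\rangle^*=\langle\eta,\xi\rangle$, $\langle\xi,\xi\rangle\ge 0$, and $\langle\xi,\xi\rangle=0$ iff $\xi=0$. It is a Hilbert $A$-module if it is complete for the topology given by the seminorms $\overline p_E(\xi)=\sqrt{p(\langle\xi,\xi\rangle)}$, $p\in S(A)$. $A$ is a Hilbert $A$-module with $\langle a,b\rangle=a^*b$. An $A$-module morphism $T:E\to F$ between Hilbert $A$-modules is adjointable if there is an $A$-module morphism $T^*:F\to E$ with $\langle T\xi,\eta\rangle=\langle\xi,T^*\eta\rangle$ for all $\xi\in E,\eta\in F$. $L_A(E,F)$ is the set of all such morphisms, and $L_A(E)=L_A(E,E)$, which is a locally $C^*$-algebra for the topology given by the seminorms sending $T$ to the norm of the operator it induces on the Hilbert $A/\ker p$-module $E/\ker\overline p_E$, $p\in S(A)$. Hilbert $A$-modules $E,F$ are unitarily equivalent if there is $U\in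 L_A(E,F)$ with $U^*U=\mathrm{id}_E$ and $UU^*=\mathrm{id}_F$. The multiplier algebra $M(A)$ is identified with the locally $C^*$-algebra $L_A(A)$. The multiplier module of a Hilbert $A$-module $E$ is $M(E)=L_A(A,E)$, a Hilbert $M(A)$-module with action $t\cdot m=t\circ m$ and inner product $\langle s,t\rangle_{M(A)}=s^*\circ t$. *)

(* Defs.v *)
(* The complex numbers are R[i] over an arbitrary R : realType. *)
From HB Require Import structures.
From mathcomp Require Import all_boot all_order all_algebra.
From mathcomp Require Import complex.
From mathcomp Require Import all_classical all_reals all_analysis.
Set Implicit Arguments.
Unset Strict Implicit.
Unset Printing Implicit Defensive.
Import Order.TTheory GRing.Theory Num.Theory.
Import numFieldNormedType.Exports.
Local Open Scope classical_set_scope.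
Local Open Scope ring_scope.
Local Open Scope complex_scope.

(* Complex *-algebras need not be unital, so they cannot be built on the
   (unital) ring structures of MathComp. *)
HB.mixin Record isStarAlgebra (R : realType) A & GRing.Lmodule R[i] A := {
  smul : A -> A -> A;
  star : A -> A;
  smulA : forall a b c : A, smul a (smul b c) = smul (smul a b) c;
  smulDl : forall a b c : A, smul (a + b) c = smul a c + smul b c;
  smulDr : forall a b c : A, smul a (b + c) = smul a b + smul a c;
  smulZl : forall (l : R[i]) (a b : A), smul (l *: a) b = l *: smul a b;
  smulZr : forall (l : R[i]) (a b : A), smul a (l *: b) = l *: smul a b;
  starD : forall a b : A, star (a + b) = star a + star b;
  starZ : forall (l : R[i]) (a : A), star (l *: a) = l^* *: star a;
  starM : forall a b : A, star (smul a b) = smul (star b) (star a);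
  starK : forall a : A, star (star a) = a }.

#[short(type="starAlgType")]
HB.structure Definition StarAlgebra (R : realType) :=
  {A of GRing.Lmodule R[i] A & isStarAlgebra R A}.

Notation "a ** b" := (smul a b) (at level 40, left associativity) : ring_scope.

(* In a locally C*-algebra, the elements b^* b are exactly the self-adjoint
   elements with nonnegative spectrum. *)
Definition positive (R : realType) (A : starAlgType R) (a : A) : Prop :=
  exists b : A, a = star b ** b.

Record Cstar_seminorm (R : realType) (A : starAlgType R) (p : A -> R) : Prop := {
  Cstar_seminormD : forall a b : A, p (a + b) <= p a + p b;
  Cstar_seminormZ : forall (l : R[i]) (a : A), p (l *: a) = Normc.normc l * p a;
  Cstar_seminormM : forall a b : A, p (a ** b) <= p a * p b;
  Cstar_seminorm_star : forall a : A, p (star a ** a) = p a ^+ 2 }.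

#[short(type="topStarAlgType")]
HB.structure Definition TopStarAlgebra (R : realType) :=
  {A of StarAlgebra R A & TopologicalLmodule R[i] A}.

Definition cont_Cstar_seminorms (R : realType) (A : topStarAlgType R) :
    set (A -> R) :=
  [set p | Cstar_seminorm p /\ continuous p].

(* The Cauchy filters of a topological abelian group. The library's cauchy is
   relative to a uniformity, which in a tvsType need not be the one given by the
   addition. *)
Definition add_cauchy (A : topologicalZmodType) (F : set_system A) : Prop :=
  forall U : set A, nbhs 0 U ->
    exists2 B : set A, F B & forall x y, B x -> B y -> U (x - y).

HB.mixin Record isLocallyCstar (R : realType) A & TopStarAlgebra R A := {
  smul_continuous : continuous (fun ab : A * A => ab.1 ** ab.2);
  star_continuous : continuous (star : A -> A);
  Cstar_hausdorff : hausdorff_space A;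
  Cstar_complete : forall F : set_system A, ProperFilter F -> add_cauchy F ->
    exists a : A, F --> a;
  Cstar_seminorms_cvg : forall (F : set_system A) (a : A), Filter F ->
    (F --> a <-> forall p : A -> R, cont_Cstar_seminorms p ->
                   p (b - a) @[b --> F] --> (0 : R)) }.

#[short(type="locallyCstarType")]
HB.structure Definition LocallyCstar (R : realType) :=
  {A of TopStarAlgebra R A & isLocallyCstar R A}.

(* Right modules with a definite hermitian A-valued form: a pre-Hilbert module
   except for the positivity of the form. *)
HB.mixin Record isInnerModule (R : realType) (A : starAlgType R) E
    & GRing.Lmodule R[i] E := {
  act : E -> A -> E;
  inner : E -> E -> A;
  actDl : forall (x y : E) (a : A), act (x + y) a = act x a + act y a;
  actDr : forall (x : E) (a b : A), act x (a + b) = act x a + act x b;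
  actA : forall (x : E) (a b : A), act x (a ** b) = act (act x a) b;
  actZl : forall (l : R[i]) (x : E) (a : A), act (l *: x) a = l *: act x a;
  actZr : forall (l : R[i]) (x : E) (a : A), act x (l *: a) = l *: act x a;
  innerDr : forall x y z : E, inner x (y + z) = inner x y + inner x z;
  innerZr : forall (l : R[i]) (x y : E), inner x (l *: y) = l *: inner x y;
  inner_act : forall (x y : E) (a : A), inner x (act y a) = inner x y ** a;
  star_inner : forall x y : E, star (inner x y) = inner y x;
  inner_eq0 : forall x : E, inner x x = 0 <-> x = 0 }.

#[short(type="innerModType")]
HB.structure Definition InnerModule (R : realType) (A : starAlgType R) :=
  {E of GRing.Lmodule R[i] E & isInnerModule R A E}.

HB.mixin Record isPreHilbert (R : realType) (A : starAlgType R) E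
    & InnerModule R A E := {
  inner_ge0 : forall x : E, positive (inner x x : A) }.

#[short(type="preHilbertModType")]
HB.structure Definition PreHilbert (R : realType) (A : starAlgType R) :=
  {E of InnerModule R A E & isPreHilbert R A E}.

Definition induced_seminorm (R : realType) (A : starAlgType R)
    (E : innerModType A) (p : A -> R) (x : E) : R :=
  Num.sqrt (p (inner x x)).

(* Completeness of E for the topology of the seminorms induced by S(A), in
   terms of the Cauchy filters of that topology. *)
HB.mixin Record isHilbert (R : realType) (A : locallyCstarType R) E
    & PreHilbert R A E := {
  hilbert_complete : forall F : set_system E, ProperFilter F ->
    (forall p : A -> R, cont_Cstar_seminorms p -> forall e : R, 0 < e ->
       exists2 B : set E, F B &
         forall x y, B x -> B y -> induced_seminorm p (x - y) < e) ->
    exists x : E, forall p : A -> R, cont_Cstar_seminorms p ->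
      induced_seminorm p (y - x) @[y --> F] --> (0 : R) }.

#[short(type="hilbertModType")]
HB.structure Definition HilbertModule (R : realType) (A : locallyCstarType R) :=
  {E of PreHilbert R A E & isHilbert R A E}.

Section InnerTheory.
Variables (R : realType) (A : starAlgType R).

Lemma smulr0 (a : A) : a ** 0 = 0.
Proof. by have := smulZr 0 a 0; rewrite !scale0r. Qed.

Lemma star0 : star 0 = 0 :> A.
Proof. by have := starZ 0 (0 : A); rewrite !rmorph0 !scale0r. Qed.

Variable E : innerModType A.
Implicit Types x y z : E.

Lemma innerDl x y z : inner (x + y) z = inner x z + inner y z.
Proof. by rewrite -star_inner innerDr starD !star_inner. Qed.

Lemma innerZl (l : R[i]) x y : inner (l *: x) y = l^* *: inner x y.
Proof. by rewrite -star_inner innerZr starZ star_inner. Qed.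

Lemma inner0r x : inner x 0 = 0 :> A.
Proof. by have := innerZr 0 x 0; rewrite !scale0r. Qed.

Lemma inner_inj x y : (forall z, inner z x = inner z y) -> x = y.
Proof.
move=> xy; apply/subr0_eq/inner_eq0.
have /(congr1 (fun a => a - inner (x - y) y)) := xy (x - y).
by rewrite subrr -[- inner _ y]scaleN1r -innerZr scaleN1r -innerDr.
Qed.

End InnerTheory.

Section Adjointable.
Variables (R : realType) (A : starAlgType R).
Implicit Types E F G : innerModType A.

Definition module_morphism E F (T : E -> F) : Prop :=
  linear T /\ forall (x : E) (a : A), T (act x a) = act (T x) a.

Definition is_adjoint E F (T : E -> F) (T' : F -> E) : Prop :=
  module_morphism T' /\ forall x y, inner (T x) y = inner x (T' y) :> A.

Definition adjointable_map E F : {pred E -> F} :=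
  fun T => `[< module_morphism T /\ exists T' : F -> E, is_adjoint T T' >].

(* L_A(E, F) *)
Record adjointable E F := Adjointable {
  adjointable_fun :> E -> F;
  adjointable_funP : adjointable_fun \in @adjointable_map E F }.

HB.instance Definition _ E F := [isSub for @adjointable_fun E F].
HB.instance Definition _ E F := [Choice of adjointable E F by <:].

Lemma adjointable_map_submod E F : submod_closed (@adjointable_map E F).
Proof.
split=> [|l S T /asboolP[[Sl SA] [S' [[Sl' SA'] SS']]]
             /asboolP[[Tl TA] [T' [[Tl' TA'] TT']]]]; apply/asboolP.
  have lin0 (G H : innerModType A) : module_morphism (0 : G -> H).
    split=> [k x y|x a]; first by rewrite /= scaler0 addr0.
    by have /esym := actZl 0 (0 : H) a; rewrite !scale0r.
  split=> //; exists 0; split=> // x y.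
  by rewrite inner0r -star_inner inner0r star0.
have lin (G H : innerModType A) k (f g : G -> H) : module_morphism f -> module_morphism g ->
    module_morphism (k *: f + g).
  move=> [fl fA] [gl gA]; split=> [m x y|x a]; rewrite !fctE.
    by rewrite fl gl scalerDr addrACA scalerDr !scalerA mulrC.
  by rewrite fA gA actDl actZl.
split; first exact: lin.
exists (l^* *: S' + T'); split=> [|x y]; first exact: lin.
by rewrite !fctE innerDl innerZl innerDr innerZr SS' TT'.
Qed.

HB.instance Definition _ E F := GRing.isSubmodClosed.Build R[i] (E -> F)
  (@adjointable_map E F) (@adjointable_map_submod E F).
HB.instance Definition _ E F :=
  [SubChoice_isSubLmodule of adjointable E F by <:].

Lemma adjointableP E F (T : adjointable E F) :
  module_morphism T /\ exists T' : F -> E, is_adjoint T T'.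
Proof. exact/asboolP/(adjointable_funP T). Qed.

Lemma adjointable_inj E F (S T : adjointable E F) : S =1 T -> S = T.
Proof. by move=> ST; apply/val_inj/funext. Qed.

Lemma adj_ex E F (T : adjointable E F) :
  exists T' : adjointable F E, forall x y, inner (T x) y = inner x (T' y) :> A.
Proof.
have [Tm [T' [T'm TT']]] := adjointableP T.
suff T'P : T' \in @adjointable_map F E by exists (Adjointable T'P).
apply/asboolP; split=> //; exists T; split=> // x y.
by rewrite -star_inner -TT' star_inner.
Qed.

Definition adj E F (T : adjointable E F) : adjointable F E :=
  projT1 (cid (adj_ex T)).

Lemma adjP E F (T : adjointable E F) x y :
  inner (T x) y = inner x (adj T y) :> A.
Proof. exact: (projT2 (cid (adj_ex T))). Qed.

Lemma adj_uniq E F (T : adjointable E F) (T' : adjointable F E) :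
  (forall x y, inner (T x) y = inner x (T' y) :> A) -> adj T = T'.
Proof.
by move=> TT'; apply: adjointable_inj => y; apply: inner_inj => x; rewrite -adjP.
Qed.

Lemma adjointable_id_subproof E : idfun \in @adjointable_map E E.
Proof. by apply/asboolP; do !split; exists idfun. Qed.

Definition adjointable_id E : adjointable E E :=
  Adjointable (adjointable_id_subproof E).

Lemma adjointable_comp_subproof E F G (S : adjointable F G)
  (T : adjointable E F) : S \o T \in @adjointable_map E G.
Proof.
have comp E' F' G' (S' : adjointable F' G') (T' : adjointable E' F') :
    module_morphism (S' \o T').
  have [[Sl SA] _] := adjointableP S'; have [[Tl TA] _] := adjointableP T'.
  by split=> [l x y|x a] /=; rewrite ?Tl ?Sl ?TA ?SA.
apply/asboolP; split; first exact: comp.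
by exists (adj T \o adj S); split=> [|x y]; [exact: comp|rewrite /= !adjP].
Qed.

Definition adjointable_comp E F G (S : adjointable F G) (T : adjointable E F) :
    adjointable E G :=
  Adjointable (adjointable_comp_subproof S T).

(* Only the module operations and the forms are involved, so this applies to
   L_A(E, F) over L_A(E), where positivity and completeness of the form are
   theorems that are not needed here. *)
Definition unitarily_equivalent E F : Prop :=
  exists U : adjointable E F,
    adjointable_comp (adj U) U = adjointable_id E /\
    adjointable_comp U (adj U) = adjointable_id F.

End Adjointable.

Section AdjointableTheory.
Variables (R : realType) (A : starAlgType R).
Implicit Types E F G : innerModType A.

Lemma adjointableDE E F (S T : adjointable E F) x : (S + T) x = S x + T x.
Proof. by []. Qed.

Lemma adjointableZE E F (l : R[i]) (T : adjointable E F) x :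
  (l *: T) x = l *: T x.
Proof. by []. Qed.

Lemma adjointable_linear E F (T : adjointable E F) l x y :
  T (l *: x + y) = l *: T x + T y.
Proof. by have [[Tl _] _] := adjointableP T; rewrite Tl. Qed.

Lemma adjointableD E F (T : adjointable E F) x y : T (x + y) = T x + T y.
Proof. by have := adjointable_linear T 1 x y; rewrite !scale1r. Qed.

Lemma adjointable0 E F (T : adjointable E F) : T 0 = 0.
Proof.
have /(congr1 (fun x => x - T 0)) := adjointableD T 0 0.
by rewrite addr0 addrK subrr.
Qed.

Lemma adjointableZ E F (T : adjointable E F) l x : T (l *: x) = l *: T x.
Proof. by have := adjointable_linear T l x 0; rewrite adjointable0 !addr0. Qed.

Lemma adjK E F (T : adjointable E F) : adj (adj T) = T.
Proof. by apply: adj_uniq => x y; rewrite -star_inner -adjP star_inner. Qed.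

Lemma adjD E F (S T : adjointable E F) : adj (S + T) = adj S + adj T.
Proof.
by apply: adj_uniq => x y; rewrite !adjointableDE innerDl innerDr !adjP.
Qed.

Lemma adjZ E F (l : R[i]) (T : adjointable E F) : adj (l *: T) = l^* *: adj T.
Proof.
by apply: adj_uniq => x y; rewrite !adjointableZE innerZl innerZr adjP.
Qed.

Lemma adj_comp E F G (S : adjointable F G) (T : adjointable E F) :
  adj (adjointable_comp S T) = adjointable_comp (adj T) (adj S).
Proof. by apply: adj_uniq => x y; rewrite /= !adjP. Qed.

Variables E F G H : innerModType A.

Lemma adjointable_compA (S : adjointable G H) (T : adjointable F G)
  (U : adjointable E F) :
  adjointable_comp S (adjointable_comp T U) =
  adjointable_comp (adjointable_comp S T) U.
Proof. exact: adjointable_inj. Qed.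

Lemma adjointable_compDl (S T : adjointable F G) (U : adjointable E F) :
  adjointable_comp (S + T) U = adjointable_comp S U + adjointable_comp T U.
Proof. exact: adjointable_inj. Qed.

Lemma adjointable_compDr (S : adjointable F G) (T U : adjointable E F) :
  adjointable_comp S (T + U) = adjointable_comp S T + adjointable_comp S U.
Proof. by apply: adjointable_inj => x; exact: adjointableD. Qed.

Lemma adjointable_compZl l (S : adjointable F G) (T : adjointable E F) :
  adjointable_comp (l *: S) T = l *: adjointable_comp S T.
Proof. exact: adjointable_inj. Qed.

Lemma adjointable_compZr l (S : adjointable F G) (T : adjointable E F) :
  adjointable_comp S (l *: T) = l *: adjointable_comp S T.
Proof. by apply: adjointable_inj => x; exact: adjointableZ. Qed.

Lemma adj_comp_eq0 (T : adjointable E F) :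
  adjointable_comp (adj T) T = 0 <-> T = 0.
Proof.
split=> [TT|->]; last by apply: adjointable_inj => x; exact: adjointable0.
apply: adjointable_inj => x; apply/inner_eq0.
by rewrite adjP -[adj T (T x)]/(adjointable_comp (adj T) T x) TT inner0r.
Qed.

End AdjointableTheory.

HB.instance Definition _ (R : realType) (A : starAlgType R)
    (E : innerModType A) :=
  isStarAlgebra.Build R (adjointable E E)
    (@adjointable_compA R A E E E E) (@adjointable_compDl R A E E E)
    (@adjointable_compDr R A E E E) (@adjointable_compZl R A E E E)
    (@adjointable_compZr R A E E E) (@adjD R A E E) (@adjZ R A E E)
    (@adj_comp R A E E E) (@adjK R A E E).

Section AdjointableModule.
Variables (R : realType) (A : starAlgType R) (E F : innerModType A).
Implicit Types (S T : adjointable E F) (M : adjointable E E).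

Let inner_op S T : adjointable E E := adjointable_comp (adj S) T.

Let star_inner_op S T : star (inner_op S T) = inner_op T S.
Proof. by rewrite /star/= /inner_op adj_comp adjK. Qed.

(* L_A(E, F) as a right L_A(E)-module, with T . M = T \o M and
   <S, T> = S^* \o T *)
HB.instance Definition _ :=
  isInnerModule.Build R (adjointable E E) (adjointable E F)
    (@adjointable_compDl R A E E F) (@adjointable_compDr R A E E F)
    (fun T M N => adjointable_compA T M N)
    (@adjointable_compZl R A E E F) (@adjointable_compZr R A E E F)
    (fun S T U => adjointable_compDr (adj S) T U)
    (fun l S T => adjointable_compZr l (adj S) T)
    (fun S T M => adjointable_compA (adj S) T M)
    star_inner_op
    (@adj_comp_eq0 R A E F).

End AdjointableModule.

(* A as a module over itself, with <a, b> = a^* b *)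
Definition regular_module (R : realType) (A : locallyCstarType R) : Type := A.

Section RegularModule.
Variables (R : realType) (A : locallyCstarType R).

Lemma Cstar_seminorm0 (p : A -> R) : Cstar_seminorm p -> p 0 = 0.
Proof.
by move=> sp; have := Cstar_seminormZ sp 0 0; rewrite scale0r Normc.normc0 mul0r.
Qed.

Lemma Cstar_seminorm_ge0 (p : A -> R) a : Cstar_seminorm p -> 0 <= p a.
Proof.
move=> sp; have := Cstar_seminormD sp a (-1 *: a).
rewrite (Cstar_seminormZ sp) scaleN1r subrr Cstar_seminorm0//.
by rewrite /= sqrrN expr1n oppr0 expr0n addr0 sqrtr1 mul1r -mulr2n pmulrn_lge0.
Qed.

Lemma star_smul_eq0 (a : A) : star a ** a = 0 <-> a = 0.
Proof.
split=> [aa0|->]; last by rewrite smulr0.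
suff cvg0 : principal_filter a --> (0 : A).
  apply: Cstar_hausdorff => U V Ua V0; exists a; split.
    exact: nbhs_singleton.
  by have := cvg0 _ V0; rewrite /= /principal_filter => /(_ a); apply.
apply/Cstar_seminorms_cvg => p [sp cp].
have pa0 : p (a - 0) = 0.
  apply/eqP; rewrite subr0 -sqrf_eq0 -(Cstar_seminorm_star sp) aa0.
  by rewrite Cstar_seminorm0.
move=> U U0; rewrite /= /nbhs/= /principal_filter/= => b ->; rewrite pa0.
exact: nbhs_singleton.
Qed.

HB.instance Definition _ := GRing.Lmodule.on (regular_module A).

Lemma star_smul (a b : A) : star (star a ** b) = star b ** a.
Proof. by rewrite starM starK. Qed.

HB.instance Definition _ := isInnerModule.Build R A (regular_module A)
  (@smulDl _ A) (@smulDr _ A) (@smulA _ A) (@smulZl _ A) (@smulZr _ A)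
  (fun a => @smulDr _ A (star a)) (fun l a => @smulZr _ A l (star a))
  (fun a => @smulA _ A (star a)) star_smul star_smul_eq0.

HB.instance Definition _ := isPreHilbert.Build R A (regular_module A)
  (fun a => ex_intro _ a erefl).

Lemma induced_seminorm_regular (p : A -> R) (a : A) : Cstar_seminorm p ->
  induced_seminorm p (a : regular_module A) = p a.
Proof.
move=> sp; rewrite /induced_seminorm /inner /= Cstar_seminorm_star// sqrtr_sqr.
by rewrite ger0_norm// Cstar_seminorm_ge0.
Qed.

Lemma regular_module_complete (F : set_system A) : ProperFilter F ->
    (forall p : A -> R, cont_Cstar_seminorms p -> forall e : R, 0 < e ->
       exists2 B : set A, F B & forall x y, B x -> B y ->
         induced_seminorm p (x - y : regular_module A) < e) ->
  exists x : A, forall p : A -> R, cont_Cstar_seminorms p ->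
    induced_seminorm p (y - x : regular_module A) @[y --> F] --> (0 : R).
Proof.
move=> FF Fc; have [|a Fa] := Cstar_complete _ FF.
  have sub0 : (fun xy : A * A => xy.1 - xy.2) @ (F, F) --> (0 : A).
    apply/Cstar_seminorms_cvg => p Sp; apply/cvgrPdist_lt => e e0.
    have [B FB Be] := Fc p Sp e e0; exists (B, B) => // -[x y] [/= Bx By].
    have [sp _] := Sp; have := Be x y Bx By.
    rewrite induced_seminorm_regular// subr0 sub0r normrN.
    by rewrite ger0_norm// Cstar_seminorm_ge0.
  move=> U /sub0[[B C] [/= FB FC] BCU]; exists (B `&` C); first exact: filterI.
  by move=> x y [Bx _] [_ Cy]; apply: (BCU (x, y)).
exists a => p Sp; have /Cstar_seminorms_cvg/(_ p Sp) := Fa.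
apply: cvg_trans; apply: near_eq_cvg; apply: nearW => b.
by rewrite (induced_seminorm_regular (b - a)) //; case: Sp.
Qed.

HB.instance Definition _ := isHilbert.Build R A (regular_module A)
  regular_module_complete.

End RegularModule.

Definition multiplier_algebra (R : realType) (A : locallyCstarType R) :
    starAlgType R :=
  adjointable (regular_module A) (regular_module A).

Definition multiplier_module (R : realType) (A : locallyCstarType R)
    (E : hilbertModType A) : innerModType (multiplier_algebra A) :=
  adjointable (regular_module A) E.

(* Main.v *)
Require Import Defs.
From mathcomp Require Import all_boot all_order all_algebra.
From mathcomp Require Import complex ring lra.
From mathcomp Require Import all_classical all_reals all_analysis.

(** A unitary U of E onto F induces the unitary m |-> U m of M(E) onto M(F).
    Conversely, E embeds in M(E) as x |-> (a |-> x a), and a unitary V of M(E)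
    onto M(F) must be shown to preserve these submodules.  The operator n = V(x)
    satisfies n^* n = a := <x, x>.  The elements
    q_m = 1 - mean of (1 + i a / m)^j for j < m^2 of A are bounded in every
    C*-seminorm, and a q_m -> a (mean ergodic theorem), so n(q_m) is a Cauchy
    sequence; its limit z satisfies n(b) = z b.

    This limit argument needs p(<y, z>)^2 <= C p(<y, y>) p(<z, z>), hence
    p(x)^2 <= C p(d^* d + x^2) for x self-adjoint.  No functional calculus is
    used: squares of self-adjoint elements are accretive, with
    ||1 - s x^2|| <= 1 + s^2 ||x||^4, and if d^* d + x^2 is close to 0 then both
    y = - d^* d and d d^* (by the parallelogram law) are almost accretive. So
    (1 + s y)^n y and (1 - s y)^n y stay bounded, while the even part of their
    expansions dominates its quadratic term. *)

Set Implicit Arguments.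
Unset Strict Implicit.
Unset Printing Implicit Defensive.
Import Order.TTheory GRing.Theory Num.Theory.
Import numFieldNormedType.Exports.
Local Open Scope classical_set_scope.
Local Open Scope ring_scope.
Local Open Scope complex_scope.

(** * Linear combinations in a module *)

Section LinearCombination.
Variables (K : comNzRingType) (V : lmodType K).

(** Reflected syntax of linear combinations: an identity in a module is reduced to ring identities
    between the coefficients of each atom. *)
Inductive lincomb : Type :=
| LAtom of nat | LAdd of lincomb & lincomb | LOpp of lincomb
| LScale of K & lincomb | LZero.

Fixpoint leval (env : seq V) e : V :=
  match e with
  | LAtom n => env`_n
  | LAdd e1 e2 => leval env e1 + leval env e2
  | LOpp e1 => - leval env e1
  | LScale k e1 => k *: leval env e1
  | LZero => 0
  end.

Fixpoint lcoef i e : K :=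
  match e with
  | LAtom n => if PeanoNat.Nat.eqb n i then 1 else 0
  | LAdd e1 e2 => lcoef i e1 + lcoef i e2
  | LOpp e1 => - lcoef i e1
  | LScale k e1 => k * lcoef i e1
  | LZero => 0
  end.

Fixpoint same_lcoefs n e1 e2 : Prop :=
  if n is m.+1 then lcoef m e1 = lcoef m e2 /\ same_lcoefs m e1 e2 else True.

Lemma levalE env e : leval env e = \sum_(i < size env) lcoef i e *: env`_i.
Proof.
elim: e => /= [n|e1 -> e2 ->|e1 ->|k e1 ->|].
- have eqb (i : nat) : PeanoNat.Nat.eqb n i = (n == i).
    by apply/idP/eqP => [/PeanoNat.Nat.eqb_eq|/PeanoNat.Nat.eqb_eq].
  have [ns|ns] := ltnP n (size env); last first.
    rewrite nth_default// big1// => i _; rewrite eqb.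
    by rewrite gtn_eqF ?scale0r// (leq_trans (ltn_ord i)).
  rewrite (bigD1 (Ordinal ns))//= eqb eqxx scale1r big1 ?addr0// => i.
  by rewrite eqb eq_sym -val_eqE /= => /negPf->; rewrite scale0r.
- by rewrite -big_split; apply: eq_bigr => i _; rewrite scalerDl.
- by rewrite -sumrN; apply: eq_bigr => i _; rewrite scaleNr.
- by rewrite scaler_sumr; apply: eq_bigr => i _; rewrite scalerA.
- by rewrite big1// => i _; rewrite scale0r.
Qed.

Lemma leval_eq env e1 e2 : same_lcoefs (size env) e1 e2 ->
  leval env e1 = leval env e2.
Proof.
rewrite !levalE; elim: (size env) => [|n IH] /=; first by rewrite !big_ord0.
by case=> en /IH; rewrite !big_ord_recr /= en => ->.
Qed.

End LinearCombination.

Ltac lindex x env :=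
  match env with
  | x :: _ => constr:(0%N)
  | _ :: ?t => let n := lindex x t in constr:(n.+1)
  end.
Ltac latoms env t :=
  lazymatch t with
  | @GRing.add _ ?a ?b => let env := latoms env a in latoms env b
  | @GRing.opp _ ?a => latoms env a
  | @GRing.scale _ _ _ ?a => latoms env a
  | @GRing.zero _ => env
  | _ => match env with
         | _ => let n := lindex t env in env
         | _ => constr:(t :: env)
         end
  end.
Ltac lreify K env t :=
  lazymatch t with
  | @GRing.add _ ?a ?b => let a := lreify K env a in let b := lreify K env b in
                          constr:(@LAdd K a b)
  | @GRing.opp _ ?a => let a := lreify K env a in constr:(@LOpp K a)
  | @GRing.scale _ _ ?k ?a => let a := lreify K env a in constr:(@LScale K k a)
  | @GRing.zero _ => constr:(@LZero K)
  | _ => let n := lindex t env in constr:(@LAtom K n)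
  end.
(* Leaves one equation of coefficients per atom; atoms are compared syntactically. *)
Ltac lincomb K V :=
  lazymatch goal with
  | |- ?l = ?r =>
    let env := latoms (@nil V) l in
    let env := latoms env r in
    let e1 := lreify K env l in
    let e2 := lreify K env r in
    refine (@leval_eq K V env e1 e2 _);
    cbn [size same_lcoefs lcoef PeanoNat.Nat.eqb];
    repeat (refine (conj _ _)); [..|exact I]
  end.

(** * C*-seminorms and accretive operators *)

Section Seminorm.
Variables (R : realType) (A : locallyCstarType R) (p : A -> R).
Hypothesis sp : Cstar_seminorm p.
Implicit Types (a b c d x y : A) (r s : R).

Let p_ge0 a : 0 <= p a := Cstar_seminorm_ge0 a sp.

Lemma smul0r a : 0 ** a = 0.
Proof. by have := smulZl 0 (0 : A) a; rewrite !scale0r. Qed.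

Lemma smulNr a b : a ** (- b) = - (a ** b).
Proof. by have := smulZr (-1) a b; rewrite !scaleN1r. Qed.

Lemma smulNl a b : (- a) ** b = - (a ** b).
Proof. by have := smulZl (-1) a b; rewrite !scaleN1r. Qed.

Lemma starN a : star (- a) = - star a.
Proof. by have := starZ (-1) a; rewrite rmorphN rmorph1 !scaleN1r. Qed.

Lemma starZr r a : star (r%:C *: a) = r%:C *: star a.
Proof. by rewrite starZ; congr (_ *: _); exact: conjc_real. Qed.

Lemma starZi a : star ('i *: a) = - ('i *: star a).
Proof.
rewrite starZ -scaleNr; congr (_ *: _).
by apply/eqP; rewrite eq_complex /= oppr0 !eqxx.
Qed.

Lemma seminormN a : p (- a) = p a.
Proof.
rewrite -scaleN1r (Cstar_seminormZ sp) /=.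
by rewrite sqrrN expr1n oppr0 expr0n addr0 sqrtr1 mul1r.
Qed.

Lemma seminormB a b : p (a - b) <= p a + p b.
Proof. by rewrite -(seminormN b); apply: Cstar_seminormD. Qed.

Lemma seminormZ r a : p (r%:C *: a) = `|r| * p a.
Proof.
by rewrite (Cstar_seminormZ sp) /= expr0n addr0 sqrtr_sqr.
Qed.

Lemma seminormZ_ge0 r a : 0 <= r -> p (r%:C *: a) = r * p a.
Proof. by move=> r0; rewrite seminormZ ger0_norm. Qed.

Lemma seminormZi a : p ('i *: a) = p a.
Proof. by rewrite (Cstar_seminormZ sp) /= expr0n expr1n add0r sqrtr1 mul1r. Qed.

(** Divide [p a ^+ 2 = p (star a ** a) <= p (star a) * p a] by [p a]. *)
Lemma seminorm_star_le a : p a <= p (star a).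
Proof.
have [->//|pa] := eqVneq (p a) 0.
have pa0 : 0 < p a by rewrite lt_def pa p_ge0.
by rewrite -(ler_pM2r pa0) -expr2 -(Cstar_seminorm_star sp) Cstar_seminormM.
Qed.

Lemma seminorm_star a : p (star a) = p a.
Proof.
apply/eqP; rewrite eq_le seminorm_star_le andbT.
by have := seminorm_star_le (star a); rewrite starK.
Qed.

Lemma seminorm_sum n (f : nat -> A) D : (forall j, (j < n)%N -> p (f j) <= D) ->
  p (\sum_(j < n) f j) <= D *+ n.
Proof.
elim: n => [|n IH] fD; first by rewrite big_ord0 (Cstar_seminorm0 sp) mulr0n.
rewrite big_ord_recr /= mulrSr; apply: le_trans (Cstar_seminormD sp _ _) _.
by apply: lerD; [apply: IH => j jn; apply: fD; apply: ltnW|apply: fD].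
Qed.

(** The cross terms add up to ['i] times the difference of the two sides of the hypothesis. *)
Lemma star_smul_addi x y : star x ** y = star y ** x ->
  star (x + 'i *: y) ** (x + 'i *: y) = star x ** x + star y ** y.
Proof.
move=> xy; rewrite starD starZi !smulDl !smulDr !smulNl !smulZl !smulZr xy.
rewrite !scalerA -expr2 sqr_i scaleN1r opprK.
by rewrite addrA addrK.
Qed.

Lemma seminorm_addi_sqr x y : star x ** y = star y ** x ->
  p (x + 'i *: y) ^+ 2 = p (star x ** x + star y ** y).
Proof. by move=> xy; rewrite -(Cstar_seminorm_star sp) star_smul_addi. Qed.

(* x is the mean of x + i y and x - i y, which have the same absolute value. *)
Lemma seminorm_sqr_le x y : star x ** y = star y ** x ->
  p x ^+ 2 <= p (star x ** x + star y ** y).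
Proof.
move=> xy; have xy1 := seminorm_addi_sqr xy.
have /seminorm_addi_sqr xy2 : star x ** (- y) = star (- y) ** x.
  by rewrite smulNr starN smulNl xy.
rewrite starN smulNl smulNr opprK in xy2.
have e : p (x + 'i *: (- y)) = p (x + 'i *: y).
  by apply/eqP; rewrite -(@eqrXn2 _ 2)// xy1 xy2.
rewrite -xy1 lerXn2r ?nnegrE// -(ler_pM2l (ltr0Sn R 1)).
have := Cstar_seminormD sp (x + 'i *: y) (x + 'i *: - y).
rewrite e scalerN addrACA subrr addr0 -mulr2n -scaler_nat.
rewrite -(rmorph_nat (real_complex R)).
rewrite seminormZ_ge0//; lra.
Qed.

(* A quantitative form of accretivity: up to e, [Q] has nonnegative numerical
   range in the seminorm [p]. *)
Definition accretive (K e : R) (Q : A -> A) : Prop :=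
  forall s b, 0 <= s -> p (b - s%:C *: Q b) <= (1 + K * s ^+ 2 + e * s) * p b.

(** 1 - s (Q + Q') is the mean of 1 - 2 s Q and 1 - 2 s Q'; evaluating at 2 s accounts for the
    factor 2 on [K + K']. *)
Lemma accretiveD K e Q K' e' Q' : accretive K e Q -> accretive K' e' Q' ->
  accretive (2 * (K + K')) (e + e') (fun b => Q b + Q' b).
Proof.
move=> Qa Qa' s b s0; have s20 : 0 <= 2 * s by lra.
have H := Qa _ b s20; have H' := Qa' _ b s20.
rewrite -(ler_pM2l (ltr0Sn R 1)) -[leLHS](@seminormZ_ge0 2)//.
have -> : 2%:C *: (b - s%:C *: (Q b + Q' b)) =
    (b - (2 * s)%:C *: Q b) + (b - (2 * s)%:C *: Q' b).
  rewrite scalerBr scalerA -rmorphM scalerDr opprD addrACA; congr (_ + _).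
  by rewrite rmorph_nat scaler_nat mulr2n.
apply: le_trans (Cstar_seminormD sp _ _) _.
apply: le_trans (lerD H H') _.
by rewrite le_eqVlt; apply/orP; left; apply/eqP; ring.
Qed.

Lemma accretiveZ r K e Q : 0 <= r -> accretive K e Q ->
  accretive (K * r ^+ 2) (e * r) (fun b => r%:C *: Q b).
Proof.
move=> r0 Qa s b s0; rewrite scalerA -rmorphM.
have := Qa (s * r) b (mulr_ge0 s0 r0).
by congr (_ <= _ * _); ring.
Qed.

Lemma accretiveW K e Q K' e' : accretive K e Q -> K <= K' -> e <= e' ->
  accretive K' e' Q.
Proof.
move=> Qa KK ee s b s0; apply: le_trans (Qa s b s0) _.
by rewrite ler_wpM2r// lerD// ?lerD// ler_wpM2r// exprn_ge0.
Qed.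

Lemma accretive_eq K e Q Q' : Q =1 Q' -> accretive K e Q -> accretive K e Q'.
Proof. by move=> QQ Qa s b s0; rewrite -QQ; apply: Qa. Qed.

Lemma accretive_bounded e Q : (forall b, p (Q b) <= e * p b) -> accretive 0 e Q.
Proof.
move=> Qe s b s0; apply: le_trans (seminormB _ _) _.
rewrite seminormZ_ge0//; have := ler_wpM2l s0 (Qe b); lra.
Qed.

(** Put c = S (S b), x = b - s c and y = sqrt(2 s) S b. By symmetry of [S], x^* x + y^* y = b^* b +
    s^2 c^* c, and [seminorm_sqr_le] bounds [p x]. *)
Lemma accretive_sqr M (S : A -> A) :
    (forall b c, star (S b) ** c = star b ** S c) ->
    (forall b, p (S b) <= M * p b) ->
  accretive (M ^+ 4) 0 (fun b => S (S b)).
Proof.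
move=> Ss SM s b s0; set r := Num.sqrt (2 * s).
have r2 : r ^+ 2 = 2 * s by rewrite sqr_sqrtr// mulr_ge0.
set x := b - _; pose y := r%:C *: S b.
have xy : star x ** y = star y ** x.
  rewrite /x /y starD starN !starZr smulZr smulZl smulDl smulDr smulNl smulNr.
  by rewrite smulZl smulZr !Ss.
have xx : star x ** x + star y ** y =
    star b ** b + (s ^+ 2)%:C *: (star (S (S b)) ** S (S b)).
  rewrite /x /y starD starN !starZr smulDl !smulDr !smulNl !smulNr opprK.
  rewrite !(smulZl, smulZr) !Ss !scalerA -!rmorphM -!expr2 r2.
  set P := star b ** b; set Z := star b ** _; set W := (_ ** _).
  rewrite mulr_natl mulr2n rmorphD scalerDl.
  by rewrite [in LHS](addrC (- _)) [X in X + _]addrACA -opprD addrNK.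
have M0 c : 0 <= M * p c by apply: le_trans (SM c).
(* The sign of [M] is only known once some [p c] is nonzero, hence the case distinction. *)
have SSM c : p (S (S c)) <= M ^+ 2 * p c.
  have [pc|pc] := eqVneq (p c) 0.
    have pSc : p (S c) <= 0 by have := SM c; rewrite pc mulr0.
    have /eqP pSc0 : p (S c) == 0 by rewrite eq_le pSc p_ge0.
    by have := SM (S c); rewrite pSc0 pc !mulr0.
  have pc0 : 0 < p c by rewrite lt_def pc p_ge0.
  have M1 : 0 <= M by have := M0 c; rewrite pmulr_lge0.
  by apply: le_trans (SM _) _; rewrite expr2 -mulrA ler_wpM2l.
have := seminorm_sqr_le xy; rewrite xx => px.
have {px} px : p x ^+ 2 <= p b ^+ 2 + s ^+ 2 * (M ^+ 2 * p b) ^+ 2.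
  apply: le_trans px _; apply: le_trans (Cstar_seminormD sp _ _) _.
  rewrite seminormZ_ge0 ?exprn_ge0// !(Cstar_seminorm_star sp) lerD2l.
  apply: ler_wpM2l; first exact: exprn_ge0.
  by apply: lerXn2r; rewrite ?nnegrE// (le_trans _ (SSM b)).
have M4 : 0 <= M ^+ 4 by rewrite -[4%N]/(2 * 2)%N exprM sqr_ge0.
have t0 : 0 <= M ^+ 4 * s ^+ 2 by apply: mulr_ge0 => //; apply: exprn_ge0.
rewrite mul0r addr0 -(@ler_pXn2r _ 2) ?nnegrE//; last first.
  by apply: mulr_ge0 => //; apply: addr_ge0.
apply: le_trans px _.
have -> : p b ^+ 2 + s ^+ 2 * (M ^+ 2 * p b) ^+ 2 =
  (1 + M ^+ 4 * s ^+ 2) * p b ^+ 2 by ring.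
rewrite exprMn ler_wpM2r ?exprn_ge0// expr2 ler_peMl ?lerDl//.
exact: addr_ge0.
Qed.

(** With v = g b + Q b, (1 + s g) b = s v + (b - s Q b). Take seminorms, divide by s and let s tend
    to 0. *)
Lemma accretive_expansive K Q g b : accretive K 0 Q ->
  g * p b <= p (g%:C *: b + Q b).
Proof.
move=> Qa; set v := g%:C *: b + Q b.
have H s : 0 < s -> g * p b <= p v + K * s * p b.
  move=> s0; have := Qa s b (ltW s0) => H.
  have H2 := Cstar_seminormD sp (s%:C *: v) (b - s%:C *: Q b).
  have e : s%:C *: v + (b - s%:C *: Q b) = (1 + s * g)%:C *: b.
    rewrite /v scalerDr scalerA -rmorphM addrCA addrC addrK.
    by rewrite rmorphD rmorph1 scalerDl scale1r addrC.
  rewrite e (seminormZ (1 + s * g)) (seminormZ s) (gtr0_norm s0) in H2.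
  have H3 := ler_wpM2r (p_ge0 b) (ler_norm (1 + s * g)).
  rewrite -(ler_pM2l s0); nra.
apply/ler_addgt0Pr => e e0.
have d0 : 0 < `|K| * p b + 1 by rewrite ltr_wpDl ?mulr_ge0.
apply: le_trans (H _ (divr_gt0 e0 d0)) _; rewrite lerD2l.
rewrite mulrAC mulrCA -[leRHS]mulr1 ler_wpM2l ?(ltW e0)//.
rewrite ler_pdivrMr// mul1r; have := ler_wpM2r (p_ge0 b) (ler_norm K); lra.
Qed.

End Seminorm.

(** * Even and odd parts of the powers of 1 + s y *)

Section Powers.
Variables (R : realType) (A : locallyCstarType R) (p : A -> R).
Hypothesis sp : Cstar_seminorm p.
Variable y : A.
Hypothesis y_sa : star y = y.
Implicit Types (a b c : A) (r s : R) (Q : A -> A).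

Let p_ge0 a : 0 <= p a := Cstar_seminorm_ge0 a sp.

Let sqy b := y ** (y ** b).

(* The operators b |-> f(y) b for even polynomials f with nonnegative
   coefficients belong to this cone. *)
Definition even_cone Q : Prop :=
  linear Q /\ forall i, exists K, accretive p K 0 (fun b => Q (iter i sqy b)).

(** Shows multiplication by y^(2i) as the square of a symmetric operator, the form required by
    [accretive_sqr]. *)
Lemma iter_sqy i b : iter i sqy b = iter i (smul y) (iter i (smul y) b).
Proof.
elim: i b => [//|i IH] b; rewrite !iterSr IH; congr (iter _ _ _).
by rewrite /sqy -iterSr iterS.
Qed.

Lemma even_cone_id : even_cone id.
Proof.
split=> [//|i]; exists ((p y ^+ i) ^+ 4).
apply: (@accretive_eq _ _ _ _ _ (fun b => iter i (smul y) (iter i (smul y) b))).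
  by move=> b; rewrite iter_sqy.
apply: accretive_sqr => // [b c|b].
  elim: i b c => [//|i IH] b c; rewrite iterS iterSr -IH starM y_sa.
  by rewrite smulA.
elim: i => [|i IH]; first by rewrite mul1r.
rewrite iterS exprS -mulrA; apply: le_trans (Cstar_seminormM sp _ _) _.
exact: ler_wpM2l.
Qed.

Lemma even_cone0 : even_cone (fun=> 0).
Proof.
split=> [k b c|i]; first by rewrite scaler0 addr0.
exists 0; apply: accretive_bounded => // b.
by rewrite Cstar_seminorm0// mul0r.
Qed.

Lemma even_coneD Q Q' : even_cone Q -> even_cone Q' ->
  even_cone (fun b => Q b + Q' b).
Proof.
move=> [Ql Qa] [Ql' Qa']; split=> [k b c|i].
  by rewrite Ql Ql' scalerDr addrACA.
have [K Ka] := Qa i; have [K' Ka'] := Qa' i; exists (2 * (K + K')).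
by rewrite -(addr0 0); apply: accretiveD.
Qed.

Lemma even_coneZ r Q : 0 <= r -> even_cone Q ->
  even_cone (fun b => r%:C *: Q b).
Proof.
move=> r0 [Ql Qa]; split=> [k b c|i].
  by rewrite Ql scalerDr !scalerA mulrC.
have [K Ka] := Qa i; exists (K * r ^+ 2).
by rewrite -(mul0r r); apply: accretiveZ.
Qed.

(** The quantification over [i] in [even_cone] provides this closure: the index is shifted by
    one. *)
Lemma even_cone_sqy Q : even_cone Q -> even_cone (fun b => Q (sqy b)).
Proof.
move=> [Ql Qa]; split=> [k b c|i].
  by rewrite /sqy !smulDr !smulZr Ql.
have [K Ka] := Qa i.+1; exists K.
exact: accretive_eq Ka.
Qed.

(* (1 + e s y)^n = 1 + g(y^2) y^2 + e h(y^2) y for e = 1 and e = -1, where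
   g and h have nonnegative coefficients, with constant terms
   ['C(n, 2)%:R * s ^+ 2] and [n%:R * s]. *)
Lemma iter_one_plus s n : 0 <= s -> exists G T : A -> A,
  [/\ even_cone G, even_cone T &
   forall (e : R) b, e * e = 1 ->
     iter n (fun b => b + (e * s)%:C *: (y ** b)) b =
     b + (('C(n, 2)%:R * s ^+ 2)%:C *: sqy b + G (sqy b))
       + e%:C *: ((n%:R * s)%:C *: (y ** b) + T (y ** b))].
Proof.
move=> s0; elim: n => [|n [G [T [Gc Tc GT]]]].
  exists (fun=> 0), (fun=> 0); split; try exact: even_cone0.
  by move=> e b _ /=; rewrite bin0n mulr0n; lincomb R[i] A; ring.
have r0 : 0 <= s * ('C(n, 2)%:R * s ^+ 2).
  by do 2 (apply: mulr_ge0 => //); apply: exprn_ge0.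
(* One more factor 1 + e s y moves odd terms to even ones and conversely; [e * e = 1] removes the
   sign from the new even terms. *)
exists (fun b => G b + s%:C *: T b),
  (fun b => T b + ((s * ('C(n, 2)%:R * s ^+ 2))%:C *: sqy b + s%:C *: G (sqy b))).
split.
- by apply: even_coneD => //; apply: even_coneZ.
- apply: even_coneD => //; apply: even_coneD; apply: even_coneZ => //.
    exact: even_cone_sqy even_cone_id.
  exact: even_cone_sqy.
- move=> e b ee; rewrite iterSr GT// /sqy.
  have lD Q : even_cone Q -> forall c d (k : R[i]), Q (c + k *: d) = Q c + k *: Q d.
    by move=> [Ql _] c d k; rewrite addrC Ql addrC.
  have [lG lT] := (lD _ Gc, lD _ Tc).
  rewrite !(smulDr, smulZr) !lG !lT binS bin1 natrD -[n.+1]addn1 natrD.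
  move/(congr1 (real_complex R)): ee; rewrite rmorphM rmorph1 => ee.
  lincomb R[i] A; ring: ee.
Qed.

End Powers.

(** * Positivity of d^* d *)

Section Positivity.
Variables (R : realType) (A : locallyCstarType R) (p : A -> R).
Hypothesis sp : Cstar_seminorm p.
Implicit Types (a b c d x y : A) (r s : R).

Let p_ge0 a : 0 <= p a := Cstar_seminorm_ge0 a sp.

Lemma iter_accretive_le K e (Q : A -> A) s n b : 0 <= K -> 0 <= e -> 0 <= s ->
    accretive p K e Q ->
  p (iter n (fun b => b - s%:C *: Q b) b) <= (1 + K * s ^+ 2 + e * s) ^+ n * p b.
Proof.
move=> K0 e0 s0 Qa; elim: n => [|n IH]; first by rewrite mul1r.
rewrite iterS exprS -mulrA; apply: le_trans (Qa _ _ s0) _.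
apply: ler_wpM2l => //.
by rewrite !addr_ge0// mulr_ge0// exprn_ge0.
Qed.

(** By induction (1 + z)^n (1 - n z) <= 1, and the second factor is at least 1/2. *)
Lemma expr_one_plus_le (z : R) n : 0 <= z -> n%:R * z <= 1 / 2 ->
  (1 + z) ^+ n <= 2.
Proof.
move=> z0 nz; have H : (1 + z) ^+ n * (1 - n%:R * z) <= 1.
  elim: n {nz} => [|n IH]; first by rewrite mul0r subr0 mulr1.
  apply: le_trans IH; rewrite exprSr -mulrA ler_wpM2l ?exprn_ge0 ?addr_ge0//.
  have n0 : 0 <= n%:R :> R by [].
  by rewrite -[n.+1]addn1 natrD; nra.
have q0 : 0 <= (1 + z) ^+ n by rewrite exprn_ge0 ?addr_ge0.
nra.
Qed.

(** The C*-identity applied twice gives p(y)^4 = p(y^4) <= p(y) p(y^3). *)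
Lemma seminorm_cube y : star y = y -> p y ^+ 3 <= p (y ** (y ** y)).
Proof.
move=> ysa; have [->|py] := eqVneq (p y) 0; first by rewrite expr0n.
have py0 : 0 < p y by rewrite lt_def py p_ge0.
have e a : star a = a -> p (a ** a) = p a ^+ 2.
  by move=> asa; rewrite -{1}asa (Cstar_seminorm_star sp).
have yy : star (y ** y) = y ** y by rewrite starM ysa.
rewrite -(ler_pM2l py0) -exprS -[4%N]/(2 * 2)%N exprM -(e _ ysa) -(e _ yy).
by rewrite -smulA Cstar_seminormM.
Qed.

(** Otherwise y = - d^* d is within 1/64 of x^2, so [p y] is close to 1. The mean of (1 + s y)^n y
    and (1 - s y)^n y is y + z with p(z) >= g p(y)^3 and g > 7, while boundedness of both powers
    gives p(z) <= 3 p(y). *)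
Lemma normalized_square_le x d : star x = x -> p x = 1 ->
  1 / 64 <= p (star d ** d + x ** x).
Proof.
move=> xsa px; rewrite leNgt; apply/negP => H.
set e := star d ** d + x ** x in H; set eta := p e in H.
have eta0 : 0 <= eta := p_ge0 e.
have pxx : p (x ** x) = 1 by rewrite -{1}xsa (Cstar_seminorm_star sp) px expr1n.
pose y := - (star d ** d).
have ysa : star y = y by rewrite /y starN starM starK.
have yE : y = x ** x - e by rewrite /y /e opprD addrCA subrr addr0.
have py : p y = p d ^+ 2 by rewrite /y seminormN// Cstar_seminorm_star.
have py1 : 63 / 64 <= p y.
  have H1 : p (x ** x) <= p y + eta.
    by rewrite -[x ** x](subrK e) -yE; apply: Cstar_seminormD.
  by rewrite pxx in H1; lra.
have py2 : p y <= 65 / 64.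
  by have := seminormB sp (x ** x) e; rewrite -yE pxx -/eta => H1; lra.
have pd : p d ^+ 2 <= 2 by rewrite -py; lra.
have xacc : accretive p 1 0 (fun b => x ** (x ** b)).
  have := @accretive_sqr _ _ _ sp 1 (smul x); rewrite expr1n; apply.
    by move=> b c; rewrite starM xsa smulA.
  by move=> b; apply: le_trans (Cstar_seminormM sp _ _) _; rewrite px.
have yacc : accretive p 260 eta (smul y).
  apply: (@accretiveW _ _ _ sp (2 * (1 + 0)) (0 + eta)); [|lra|lra].
  apply: (@accretive_eq _ _ _ _ _ (fun b => x ** (x ** b) + - (e ** b))).
    by move=> b; rewrite yE [RHS]smulDl [in RHS]smulNl smulA.
  apply: accretiveD => //; apply: accretive_bounded => // b.
  by rewrite seminormN// Cstar_seminormM.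
have sqacc z : star z = z -> p z <= 2 * p d ->
    accretive p 64 0 (fun b => z ** (z ** b)).
  move=> zsa pz; apply: (@accretiveW _ _ _ sp (p z ^+ 4) 0) => //.
    apply: accretive_sqr => // [b c|b]; last exact: Cstar_seminormM.
    by rewrite starM zsa smulA.
  have pz2 : p z ^+ 2 <= 8 by have := p_ge0 z; have := p_ge0 d; nra.
  by rewrite -[4%N]/(2 * 2)%N exprM; have := sqr_ge0 (p z); nra.
have ddacc : accretive p 260 eta (smul (d ** star d)).
  have u_acc : accretive p 64 0
      (fun b => (d + star d) ** ((d + star d) ** b)).
    apply: sqacc; first by rewrite starD starK addrC.
    by have := Cstar_seminormD sp d (star d); rewrite seminorm_star//; lra.
  have v_acc : accretive p 64 0
      (fun b => ('i *: (d - star d)) ** (('i *: (d - star d)) ** b)).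
    apply: sqacc; first by rewrite starZi starD starN starK -scalerN opprB.
    rewrite seminormZi//.
    by have := seminormB sp d (star d); rewrite seminorm_star//; lra.
  have e_acc : accretive p 0 (2 * eta) (fun b => - (2%:C *: (e ** b))).
    apply: accretive_bounded => // b.
    rewrite seminormN// seminormZ_ge0// -mulrA ler_wpM2l//.
    exact: Cstar_seminormM.
  have xx_acc := @accretiveZ _ _ p 2 _ _ _ (ler0n _ _) xacc.
  have := accretiveD sp (accretiveD sp u_acc v_acc) (accretiveD sp xx_acc e_acc).
  move/(@accretiveZ _ _ p 2^-1); rewrite invr_ge0 => /(_ (ler0n _ _)).
  move=> acc; apply: (@accretiveW _ _ _ sp _ _ _ _ _ (accretive_eq _ acc)).
  - move=> b.
    have -> : d ** star d ** b = 2^-1%:C *: (2%:C *: (d ** star d ** b)).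
      by rewrite scalerA -rmorphM mulVf ?pnatr_eq0// scale1r.
    congr (_ *: _).
    have sq : (d + star d) ** (d + star d) +
        ('i *: (d - star d)) ** ('i *: (d - star d)) =
        2%:C *: (d ** star d) + 2%:C *: (star d ** d).
      rewrite smulZl smulZr scalerA -expr2 sqr_i !(smulDl, smulDr, smulNl, smulNr).
      rewrite (rmorph_nat (real_complex R)).
      by lincomb R[i] A; ring.
    rewrite !smulA -smulDl sq -[x ** x](addKr (star d ** d)) -/e.
    rewrite !(smulDl, smulNl, smulZl).
    by lincomb R[i] A; ring.
  - by lra.
  - by lra.
have [n n_gt] : exists n : nat, 260 * 256 < n%:R :> R.
  by exists (Num.bound (260 * 256 : R)); apply: archi_boundP; rewrite mulr_ge0.
(* Keeping n s = 8 makes n (q - 1) at most 1/4 + 1/8, so q^n <= 2, while the quadratic coefficient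
   'C(n, 2) s^2 = 4 (8 - s) stays large. *)
pose s := 8 / n%:R : R.
have n0 : 0 < n%:R :> R by apply: lt_trans n_gt; rewrite mulr_gt0.
have s0 : 0 <= s by rewrite divr_ge0.
have ns : n%:R * s = 8 by rewrite /s mulrCA divff ?mulr1// gt_eqF.
set q := 1 + 260 * s ^+ 2 + eta * s.
have qn : q ^+ n <= 2.
  rewrite /q -addrA; apply: expr_one_plus_le.
    by apply: addr_ge0; apply: mulr_ge0 => //; rewrite exprn_ge0.
  have -> : n%:R * (260 * s ^+ 2 + eta * s) =
      260 * (n%:R * s) * s + eta * (n%:R * s).
    by ring.
  rewrite ns; have : 260 * 256 * s <= 8 by rewrite -ns ler_wpM2r// ltW.
  lra.
have Yn : p (iter n (fun b => b + (- 1 * s)%:C *: (y ** b)) y) <= 2 * p y.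
  have -> : (fun b => b + (- 1 * s)%:C *: (y ** b)) =
            (fun b => b - s%:C *: (y ** b)).
    by apply/funext => b; rewrite mulN1r rmorphN scaleNr.
  apply: le_trans (iter_accretive_le _ _ _ _ _ yacc) _ => //.
  by rewrite -/q ler_wpM2r.
have Xn : p (iter n (fun b => b + (1 * s)%:C *: (y ** b)) y) <= 2 * p y.
  have -> : iter n (fun b => b + (1 * s)%:C *: (y ** b)) y =
      star d ** iter n (fun b => b - s%:C *: (d ** star d ** b)) (- d).
    elim: (n) => [|m IH]; first by rewrite smulNr.
    rewrite !iterS IH mul1r; set c := iter m _ _.
    by rewrite smulDr smulNr smulZr /y smulNl !smulA scalerN.
  apply: le_trans (Cstar_seminormM sp _ _) _; rewrite seminorm_star//.
  rewrite py expr2 mulrCA ler_wpM2l// -(seminormN sp d).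
  apply: le_trans (iter_accretive_le _ _ _ _ _ ddacc) _ => //.
  by rewrite -/q ler_wpM2r.
have [G [T [Gc _ GT]]] := iter_one_plus sp ysa n s0.
set g := _ * s ^+ 2 in GT.
have g6 : 7 < g.
  have n1 : (0 < n)%N by rewrite -(ltr_nat R).
  have : 'C(n, 2)%:R * 2 = n%:R * (n%:R - 1) :> R.
    have /(congr1 (fun k => k%:R : R)) := bin_ffact n 2.
    rewrite ffactnS ffactn1 !natrM => ->.
    by congr (_ * _); rewrite -[in RHS](prednK n1) -[n.-1.+1]addn1 natrD addrK.
  have s1 : s <= 1 by rewrite ler_pdivrMr// mul1r; lra.
  move=> /(congr1 (fun r => r * s ^+ 2)) e2.
  have -> : g = (8 - s) * 4.
    have : g * 2 = (n%:R * s) * (n%:R * s - s) by rewrite /g mulrAC e2; ring.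
    by rewrite ns; lra.
  lra.
have HG : g * p (y ** (y ** y)) <= p (g%:C *: (y ** (y ** y)) + G (y ** (y ** y))).
  have [_ /(_ 0%N)[K Ka]] := Gc.
  exact: accretive_expansive Ka.
(* The odd parts for e = 1 and e = -1 cancel. *)
have sum : 2%:C *: (y + (g%:C *: (y ** (y ** y)) + G (y ** (y ** y)))) =
    iter n (fun b => b + (1 * s)%:C *: (y ** b)) y +
    iter n (fun b => b + (- 1 * s)%:C *: (y ** b)) y.
  rewrite !GT ?mulr1 ?mulrNN ?mulr1// (rmorph_nat (real_complex R)) rmorphN rmorph1.
  by lincomb R[i] A; ring.
have bound : p (g%:C *: (y ** (y ** y)) + G (y ** (y ** y))) <= 3 * p y.
  set z := g%:C *: _ + _ in sum *.
  have := Cstar_seminormD sp (iter n (fun b => b + (1 * s)%:C *: (y ** b)) y)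
    (iter n (fun b => b + (- 1 * s)%:C *: (y ** b)) y).
  rewrite -sum seminormZ_ge0// => H1.
  have H2 := seminormB sp (y + z) y; rewrite addrAC subrr add0r in H2; lra.
have py3 : 9 / 10 <= p y ^+ 3 by rewrite exprS expr2; nra.
have := seminorm_cube ysa; nra.
Qed.

(** Both sides are homogeneous of degree 2, so [x] and [d] may be divided by [p x]. *)
Lemma square_seminorm_le x d : star x = x ->
  p x ^+ 2 <= 64 * p (star d ** d + x ** x).
Proof.
move=> xsa; have [->|px] := eqVneq (p x) 0.
  by rewrite expr0n mulr_ge0.
have px0 : 0 < p x by rewrite lt_def px p_ge0.
pose r := (p x)^-1; have r0 : 0 < r by rewrite invr_gt0.
have rz z : p (r%:C *: z) = r * p z by apply: seminormZ_ge0 => //; apply: ltW.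
have := @normalized_square_le (r%:C *: x) (r%:C *: d).
rewrite !starZr xsa rz (mulVf px : r * p x = 1) => /(_ erefl erefl).
rewrite !(smulZl, smulZr) -!scalerDr !rz => H.
have rx : p x * r = 1 by rewrite mulfV.
set P := p _ in H *; have P0 : 0 <= P by apply: p_ge0.
have : p x * (p x * (1 / 64)) <= p x * (p x * (r * (r * P))).
  by apply: ler_wpM2l => //; apply: ler_wpM2l.
have -> : p x * (p x * (r * (r * P))) = (p x * r) * (p x * r) * P by ring.
rewrite rx; lra.
Qed.

End Positivity.

(** * The Cauchy-Schwarz inequality and the mean ergodic theorem *)

Section CauchySchwarz.
Variables (R : realType) (A : locallyCstarType R) (p : A -> R).
Hypothesis sp : Cstar_seminorm p.
Variable E : preHilbertModType A.
Implicit Types (x y z : E).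

Let p_ge0 a : 0 <= p a := Cstar_seminorm_ge0 a sp.

Lemma innerBr (E' : innerModType A) (x y z : E') :
  inner x (y - z) = inner x y - inner x z :> A.
Proof. by rewrite -[- z]scaleN1r innerDr innerZr scaleN1r. Qed.

Lemma innerBl (E' : innerModType A) (x y z : E') :
  inner (x - y) z = inner x z - inner y z :> A.
Proof. by rewrite -star_inner innerBr starD starN !star_inner. Qed.

Lemma inner_actl (E' : innerModType A) (x y : E') (a : A) :
  inner (act x a) y = star a ** inner x y.
Proof. by rewrite -star_inner inner_act starM star_inner. Qed.

(* Expand the positive element <w, w> for w = z - y b, b = t c c^* c. *)
Lemma inner_seminorm_scaled y z (t : R) : 0 <= t ->
  2 * t * p (inner y z) ^+ 4 <=
  64 * (p (inner z z) + t ^+ 2 * p (inner y z) ^+ 6 * p (inner y y)).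
Proof.
move=> t0; set c := inner y z; set h := star c ** c.
have hsa : star h = h by rewrite /h starM starK.
have ph : p h = p c ^+ 2 by rewrite /h Cstar_seminorm_star.
pose b := t%:C *: (c ** h); pose r := Num.sqrt (2 * t).
have r2 : r ^+ 2 = 2 * t by rewrite sqr_sqrtr// mulr_ge0.
have pb : p b <= t * p c ^+ 3.
  rewrite seminormZ_ge0// ler_wpM2l//; apply: le_trans (Cstar_seminormM sp _ _) _.
  by rewrite ph -exprS.
have [d ww] := inner_ge0 (z - act y b).
have := @square_seminorm_le _ _ _ sp (r%:C *: h) d.
rewrite starZr hsa => /(_ erefl).
have -> : p (r%:C *: h) ^+ 2 = 2 * t * p c ^+ 4.
  by rewrite seminormZ_ge0 ?sqrtr_ge0// ph exprMn r2 -exprM.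
move=> H; apply: le_trans H _; rewrite ler_wpM2l//.
(* Each cross term of <w, w> equals - t h^2; adding (r h)^2 with r^2 = 2 t cancels both. *)
have -> : star d ** d + (r%:C *: h) ** (r%:C *: h) =
    inner z z + star b ** (inner y y ** b).
  rewrite -ww innerBr !innerBl !inner_act !inner_actl -/c.
  have -> : (r%:C *: h) ** (r%:C *: h) = (2 * t)%:C *: (h ** h).
    by rewrite smulZl smulZr scalerA -rmorphM -expr2 r2.
  have -> : inner z y = star c by rewrite /c star_inner.
  have -> : star b ** c = t%:C *: (h ** h).
    by rewrite /b starZr starM hsa !smulZl -smulA.
  have -> : star c ** b = t%:C *: (h ** h).
    by rewrite /b smulZr smulA.
  rewrite -smulA (rmorphM (real_complex R)) (rmorph_nat (real_complex R)).
  set al := inner z z; set be := star b ** _.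
  by lincomb R[i] A; ring.
apply: le_trans (Cstar_seminormD sp _ _) _; rewrite lerD2l.
apply: le_trans (Cstar_seminormM sp _ _) _; rewrite seminorm_star//.
apply: le_trans (ler_wpM2l (p_ge0 _) (Cstar_seminormM sp _ _)) _.
have -> : p b * (p (inner y y) * p b) = p b ^+ 2 * p (inner y y) by ring.
apply: ler_wpM2r => //.
have -> : t ^+ 2 * p c ^+ 6 = (t * p c ^+ 3) ^+ 2 by ring.
by apply: lerXn2r; rewrite ?nnegrE// mulr_ge0// exprn_ge0.
Qed.

(** For t = 1 / (64 P^2 be) the quadratic term of [inner_seminorm_scaled] absorbs half of the left
    side, leaving t P^4 <= 64 al. Since [be] may vanish, it is replaced by [be + f], where [f] costs
    at most [e]. *)
Lemma inner_seminorm_le y z :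
  p (inner y z) ^+ 2 <= (64 * 64) * p (inner z z) * p (inner y y).
Proof.
set P := p (inner y z); set al := p (inner z z); set be := p (inner y y).
have [al0 be0] : 0 <= al /\ 0 <= be by split; apply: p_ge0.
have H (t : R) : 0 <= t -> 2 * t * P ^+ 4 <= 64 * (al + t ^+ 2 * P ^+ 6 * be).
  exact: inner_seminorm_scaled.
have [->|P0] := eqVneq P 0; first by rewrite expr0n/=; do 2 apply: mulr_ge0 => //.
have {}P0 : 0 < P by rewrite lt_def P0 p_ge0.
apply/ler_addgt0Pr => e e0.
pose f := e / ((64 * 64) * al + 1).
have den : 0 < (64 * 64) * al + 1 by lra.
have f0 : 0 < f by rewrite divr_gt0.
have fE : (64 * 64) * al * f <= e.
  by rewrite /f mulrCA ger_pMr// ler_pdivrMr// mul1r; lra.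
pose B := be + f; have B0 : 0 < B by rewrite ltr_wpDl.
pose t := (64 * P ^+ 2 * B)^-1.
have D0 : 0 < 64 * P ^+ 2 * B by rewrite !mulr_gt0// exprn_gt0.
have t0 : 0 < t by rewrite invr_gt0.
have tD : t * (64 * P ^+ 2 * B) = 1 by rewrite mulVf// gt_eqF.
have := H t (ltW t0).
have -> : 64 * (al + t ^+ 2 * P ^+ 6 * be) =
  64 * al + t * (64 * P ^+ 2 * be) * (t * P ^+ 4) by ring.
have tb : t * (64 * P ^+ 2 * be) <= 1.
  have c0 : 0 < 64 * P ^+ 2 by rewrite mulr_gt0// exprn_gt0.
  apply: le_trans (_ : t * (64 * P ^+ 2 * B) <= 1); last by rewrite tD.
  by rewrite ler_pM2l// ler_pM2l// lerDl ltW.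
have tP : 0 <= t * P ^+ 4 by rewrite mulr_ge0 ?ltW// exprn_gt0.
have := ler_wpM2r tP tb; rewrite mul1r => H1 H2.
have H3 : t * P ^+ 4 <= 64 * al by lra.
have := ler_wpM2r (ltW D0) H3.
have -> : t * P ^+ 4 * (64 * P ^+ 2 * B) = P ^+ 4 * (t * (64 * P ^+ 2 * B)) by ring.
rewrite tD mulr1.
have -> : 64 * al * (64 * P ^+ 2 * B) = P ^+ 2 * ((64 * 64) * al * B) by ring.
rewrite -[4%N]/(2 + 2)%N exprD ler_pM2l ?exprn_gt0// => H4.
by apply: le_trans H4 _; rewrite /B mulrDr lerD2l.
Qed.

End CauchySchwarz.

(** The principal filter at [a] converges to 0 in every seminorm, and A is Hausdorff. *)
Lemma seminorm_eq0 (R : realType) (A : locallyCstarType R) (a : A) :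
  (forall p : A -> R, cont_Cstar_seminorms p -> p a = 0) -> a = 0.
Proof.
move=> pa0.
suff cvg0 : principal_filter a --> (0 : A).
  apply: Cstar_hausdorff => U V Ua V0; exists a; split.
    exact: nbhs_singleton.
  by have := cvg0 _ V0; rewrite /= /principal_filter => /(_ a); apply.
apply/Cstar_seminorms_cvg => p Sp; have [sp cp] := Sp => U U0.
rewrite /= /nbhs/= /principal_filter/= => b ->; rewrite subr0 (pa0 _ Sp).
exact: nbhs_singleton.
Qed.

(** * Ergodic means of a self-adjoint element *)

Section MeanErgodic.
Variables (R : realType) (A : locallyCstarType R) (a : A).
Hypothesis a_sa : star a = a.

Let r m : R := m.+1%:R^-1.

(* [(1 + i a / (m + 1)) ^ j - 1], which lies in A even if A has no unit. *)
Fixpoint unitary_power m j : A :=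
  if j is i.+1 then
    unitary_power m i + ('i * (r m)%:C) *: (a ** unitary_power m i + a)
  else 0.

(* One minus the mean of the powers [(1 + i a / (m + 1)) ^ j]. *)
Definition mean_ergodic m : A :=
  - ((r m ^+ 2)%:C *: \sum_(j < m.+1 ^ 2) unitary_power m j).

Section Bounds.
Variable p : A -> R.
Hypothesis sp : Cstar_seminorm p.

Let p_ge0 a : 0 <= p a := Cstar_seminorm_ge0 a sp.

Let r_ge0 m : 0 <= r m. Proof. by rewrite invr_ge0. Qed.

(** The exponential bounds (1 + (p(a) / (m + 1))^2)^j for j <= (m + 1)^2; the extra 1 pays for the
    subtracted unit. *)
Let D : R := expR (p a ^+ 2) + 1.

(** As a is self-adjoint, 1 + i r a enlarges p only to second order in r, so about 1 / r^2 factors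
    keep the bound finite. *)
Lemma unitary_power_mul_le m j (b : A) :
  p (b + unitary_power m j ** b) <= (1 + (r m * p a) ^+ 2) ^+ j * p b.
Proof.
have C0 : 0 <= (r m * p a) ^+ 2 by apply: sqr_ge0.
elim: j => [|j IH] /=; first by rewrite smul0r addr0 mul1r.
set v := b + _ in IH.
have -> : b + (unitary_power m j +
      ('i * (r m)%:C) *: (a ** unitary_power m j + a)) ** b =
    v + 'i *: ((r m)%:C *: (a ** v)).
  rewrite /v !(smulDl, smulDr, smulZl, smulZr) !smulA.
  by lincomb R[i] A; ring.
rewrite exprS -mulrA; apply: le_trans (ler_wpM2l _ IH); last by rewrite addr_ge0.
rewrite -(@ler_pXn2r _ 2) ?nnegrE//; last by rewrite mulr_ge0// addr_ge0.
rewrite (seminorm_addi_sqr sp); last first.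
  by rewrite starZr starM a_sa smulZl smulZr smulA.
apply: le_trans (Cstar_seminormD sp _ _) _.
rewrite !(Cstar_seminorm_star sp) seminormZ_ge0//.
have H : (r m * p (a ** v)) ^+ 2 <= (r m * p a) ^+ 2 * p v ^+ 2.
  rewrite -exprMn; apply: lerXn2r; rewrite ?nnegrE ?mulr_ge0//.
  by rewrite -mulrA ler_wpM2l// Cstar_seminormM.
have := p_ge0 v; have := sqr_ge0 (p v); nra.
Qed.

(** For u = [unitary_power m j], write u u^* = (u^* + u u^* ) - u^*, bound the bracket by the
    previous lemma at b = u^*, and divide by p(u). *)
Lemma unitary_power_le m j : (j <= m.+1 ^ 2)%N -> p (unitary_power m j) <= D.
Proof.
move=> jm; set u := unitary_power m j.
have [->|pu] := eqVneq (p u) 0; first by rewrite addr_ge0// expR_ge0.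
have pu0 : 0 < p u by rewrite lt_def pu p_ge0.
have uu : p u * p u = p (u ** star u).
  by rewrite -{3}(starK u) (Cstar_seminorm_star sp) (seminorm_star sp) expr2.
rewrite -(ler_pM2r pu0) uu -(addKr (star u) (u ** star u)) addrC.
apply: le_trans (seminormB sp _ _) _; rewrite seminorm_star// mulrDl mul1r lerD2r.
apply: le_trans (unitary_power_mul_le _ _ _) _; rewrite seminorm_star// ler_wpM2r//.
have x0 : 0 <= (r m * p a) ^+ 2 by apply: sqr_ge0.
apply: (@le_trans _ _ ((1 + (r m * p a) ^+ 2) ^+ (m.+1 ^ 2))).
  by rewrite ler_weXn2l// lerDl.
apply: (@le_trans _ _ (expR ((r m * p a) ^+ 2) ^+ (m.+1 ^ 2))).
  by apply: lerXn2r; rewrite ?nnegrE ?expR_ge0 ?addr_ge0// expR_ge1Dx.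
rewrite -expRM_natl exprMn mulrA natrX /r -exprMn divff ?expr1n ?mul1r//.
Qed.

Lemma mean_ergodic_le m : p (mean_ergodic m) <= D.
Proof.
rewrite seminormN// seminormZ_ge0 ?sqr_ge0//.
have H : p (\sum_(j < m.+1 ^ 2) unitary_power m j) <= D *+ m.+1 ^ 2.
  by apply: seminorm_sum => // j jm; apply/unitary_power_le/ltnW.
apply: le_trans (ler_wpM2l (sqr_ge0 _) H) _.
by rewrite -mulr_natl mulrA natrX /r -exprMn mulVf// expr1n mul1r.
Qed.

(** Summing the recursion gives u_k = i r (k a + a (u_0 + ... + u_(k-1))); at k = (m + 1)^2 = 1 /
    r^2 the bracket is k (a - a q_m). *)
Lemma mean_ergodic_telescope m :
  (m.+1%:R : R)%:C *: ('i *: (a - a ** mean_ergodic m)) =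
  unitary_power m (m.+1 ^ 2).
Proof.
have H k : unitary_power m k = ('i * (r m)%:C) *:
    (k%:R *: a + a ** \sum_(j < k) unitary_power m j).
  elim: k => [|k IH]; first by rewrite big_ord0 smulr0 scale0r addr0 scaler0.
  rewrite big_ord_recr /= {1}IH smulDr -[k.+1]addn1 natrD.
  set u := a ** unitary_power m k.
  set w := a ** \sum_(_ < _) _.
  by lincomb R[i] A; ring.
rewrite H /mean_ergodic smulNr smulZr natrX.
have e : (m.+1%:R : R[i]) * (r m)%:C = 1.
  by rewrite -(rmorph_nat (real_complex R)) -rmorphM divff// rmorph1.
rewrite (rmorph_nat (real_complex R)).
have -> : (r m ^+ 2)%:C = (r m)%:C ^+ 2 by rewrite rmorphXn.
move: e; set rho := real_complex R (r m); set M : R[i] := m.+1%:R => e.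
by clearbody rho M; lincomb R[i] A; ring: e.
Qed.

Lemma mean_ergodic_cvg m : p (a - a ** mean_ergodic m) <= D / m.+1%:R.
Proof.
rewrite ler_pdivlMr// mulrC -(seminormZi sp) -seminormZ_ge0//.
by rewrite mean_ergodic_telescope unitary_power_le.
Qed.

End Bounds.
End MeanErgodic.

(** * Multiplier modules *)

Section Factorization.
Variables (R : realType) (A : locallyCstarType R) (E : hilbertModType A).

Lemma inner_diag_act (n : adjointable (regular_module A) E) (a : A) :
    (forall b : A, adj n (n b) = a ** b :> A) ->
  forall b c : A, inner (n b) (n c) = star b ** (a ** c) :> A.
Proof. by move=> na b c; rewrite adjP na. Qed.

(* z is the limit of [n (q m)], i.e. the value of n at the possibly missing unit
   of A. *)
Lemma adjointable_eq_act (n : adjointable (regular_module A) E) (a : A) :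
    star a = a -> (forall b : A, adj n (n b) = a ** b :> A) ->
  exists z : E, forall b : A, n b = act z b.
Proof.
move=> a_sa na; have nn := inner_diag_act na.
have nB (b c : A) : n (b - c) = n b - n c.
  rewrite -[c in LHS]opprK opprK -scaleN1r addrC.
  by rewrite (adjointable_linear n) scaleN1r addrC.
pose q := mean_ergodic a.
have bound p : Cstar_seminorm p -> exists2 D : R, 0 <= D &
    forall m, p (q m) <= D /\ p (a - a ** q m) <= D / m.+1%:R.
  move=> sp; exists (expR (p a ^+ 2) + 1); first by rewrite addr_ge0// expR_ge0.
  by move=> m; split; [apply: mean_ergodic_le|apply: mean_ergodic_cvg].
have FF : ProperFilter ((fun m => n (q m)) @ \oo) by exact: fmap_proper_filter.
have [p [sp _] e e0|z zE] := hilbert_complete _ FF.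
  have [D D0 qD] := bound p sp.
  have e20 : 0 < e ^+ 2 by rewrite exprn_gt0.
  have [N NE] : exists N : nat, 4 * D ^+ 2 < e ^+ 2 * N.+1%:R.
    exists (Num.bound (4 * D ^+ 2 / e ^+ 2)).
    have x0 : 0 <= 4 * D ^+ 2 / e ^+ 2.
      by apply: divr_ge0; [apply: mulr_ge0 => //; apply: sqr_ge0|apply: ltW].
    rewrite [ltRHS]mulrC -ltr_pdivrMr//; apply: lt_le_trans (archi_boundP x0) _.
    by rewrite ler_nat.
  exists [set n (q m) | m in [set m | (N <= m)%N]].
    by exists N => // m Nm; exists m.
  move=> _ _ [i /= Ni <-] [j /= Nj <-].
  (* With v = q_i - q_j, <n v, n v> = v^* a v: here v^* is bounded by 2 D and a v by 2 D / (N +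
     1). *)
  rewrite /induced_seminorm -nB nn.
  rewrite -(ger0_norm (ltW e0)) -sqrtr_sqr ltr_sqrt//.
  apply: le_lt_trans (Cstar_seminormM sp _ _) _; rewrite seminorm_star//.
  have DN k : (N <= k)%N -> p (a - a ** q k) <= D / N.+1%:R.
    move=> Nk; apply: le_trans (proj2 (qD k)) _.
    by rewrite ler_wpM2l// lef_pV2 ?posrE// ler_nat.
  have H1 : p (q i - q j) <= 2 * D.
    apply: le_trans (seminormB sp _ _) _.
    rewrite mulr_natl mulr2n; apply: lerD; [exact: (qD i).1|exact: (qD j).1].
  have H2 : p (a ** (q i - q j)) <= 2 * (D / N.+1%:R).
    have -> : a ** (q i - q j) = (a - a ** q j) - (a - a ** q i).
      by rewrite smulDr smulNr; lincomb R[i] A; ring.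
    apply: le_trans (seminormB sp _ _) _.
    by rewrite mulr_natl mulr2n; apply: lerD; apply: DN.
  apply: le_lt_trans (ler_pM _ _ H1 H2) _; try exact: Cstar_seminorm_ge0.
  have -> : 2 * D * (2 * (D / N.+1%:R)) = 4 * D ^+ 2 / N.+1%:R by ring.
  by rewrite ltr_pdivrMr.
exists z => b; apply: inner_inj => y; apply/subr0_eq/seminorm_eq0 => p Sp.
have [sp _] := Sp; have p_ge0 c : 0 <= p c := Cstar_seminorm_ge0 c sp.
apply/eqP; rewrite eq_le p_ge0 andbT; apply/ler_addgt0Pr => e e0; rewrite add0r.
have [D D0 qD] := bound p sp.
set Y := (64 * 64) * p (inner y y).
have Y0 : 0 <= Y by rewrite mulr_ge0.
pose C := Y * (p b ^+ 2 * (1 + D) * D).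
have e2 : 0 < e / 2 by rewrite divr_gt0.
pose f := e / 2 / (Num.sqrt Y * p b + 1).
have den : 0 < Num.sqrt Y * p b + 1 by rewrite ltr_wpDl// mulr_ge0// sqrtr_ge0.
have f0 : 0 < f by rewrite divr_gt0.
have near1 : \forall m \near \oo, C / m.+1%:R < (e / 2) ^+ 2.
  have x0 : 0 <= C / (e / 2) ^+ 2.
    apply: divr_ge0; last exact: sqr_ge0.
    rewrite mulr_ge0// mulr_ge0// mulr_ge0 ?sqr_ge0//.
    exact: addr_ge0.
  exists (Num.bound (C / (e / 2) ^+ 2)) => // m /= Nm.
  rewrite ltr_pdivrMr// [ltRHS]mulrC -ltr_pdivrMr ?exprn_gt0//.
  apply: lt_le_trans (archi_boundP x0) _.
  by rewrite ler_nat leqW.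
have near2 : \forall m \near \oo, induced_seminorm p (n (q m) - z) < f.
  have /cvgrPdist_lt/(_ _ f0) := zE p Sp.
  rewrite near_map; apply: filterS => m.
  by rewrite sub0r normrN ger0_norm ?sqrtr_ge0.
have [m [m1 m2]] := filter_ex (filterI near1 near2).
rewrite inner_act.
(* The first term tends to 0 by Cauchy-Schwarz, since a (b - q_m b) = (a - a q_m) b is small, with
   square at most C / (m + 1); the second by convergence of n(q_m) to z. *)
have -> : inner y (n b) - inner y z ** b =
    inner y (n (b - q m ** b)) + inner y (n (q m) - z) ** b :> A.
  have nA : n (q m ** b) = act (n (q m)) b.
    by have [[_ nA] _] := adjointableP n; apply: nA.
  rewrite nB nA !innerBr inner_act smulDl smulNl.
  by lincomb R[i] A; ring.
apply: le_trans (Cstar_seminormD sp _ _) _; rewrite [e]splitr; apply: lerD.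
  have h0 := ltW e2.
  rewrite -(@ler_pXn2r _ 2) ?nnegrE//; apply: le_trans (ltW m1).
  apply: le_trans (inner_seminorm_le sp _ _) _.
  have -> : C / m.+1%:R = p b * (1 + D) * (p b * (D / m.+1%:R)) * Y.
    by rewrite /C; ring.
  rewrite [_ * _ * p _]mulrAC [leLHS]mulrC -/Y; apply: ler_wpM2r => //.
  rewrite nn; have [qm zm] := qD m.
  apply: le_trans (Cstar_seminormM sp _ _) _; rewrite seminorm_star//.
  apply: ler_pM => //.
    apply: le_trans (seminormB sp _ _) _; rewrite mulrDr mulr1 lerD2l mulrC.
    apply: le_trans (Cstar_seminormM sp _ _) _.
    by rewrite ler_wpM2r.
  have -> : a ** (b - q m ** b) = (a - a ** q m) ** b.
    by rewrite smulDr smulNr smulA smulDl -[in LHS]smulNl.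
  apply: le_trans (Cstar_seminormM sp _ _) _.
  by rewrite mulrC ler_wpM2l.
apply: le_trans (Cstar_seminormM sp _ _) _.
have H : p (inner y (n (q m) - z)) <= Num.sqrt Y * induced_seminorm p (n (q m) - z).
  rewrite -(@ler_pXn2r _ 2) ?nnegrE// ?mulr_ge0 ?sqrtr_ge0//.
  rewrite exprMn !sqr_sqrtr//; apply: le_trans (inner_seminorm_le sp _ _) _.
  by rewrite /Y mulrAC.
apply: le_trans (ler_wpM2r (p_ge0 _) H) _.
have [S0 I0] : 0 <= Num.sqrt Y /\ 0 <= induced_seminorm p (n (q m) - z).
  by split; apply: sqrtr_ge0.
have fE : f * (Num.sqrt Y * p b + 1) = e / 2 by rewrite /f mulfVK// gt_eqF.
have := p_ge0 b => b0.
have H1 : Num.sqrt Y * induced_seminorm p (n (q m) - z) * p b <=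
    Num.sqrt Y * p b * f.
  by rewrite mulrAC ler_wpM2l ?mulr_ge0// ltW.
apply: le_trans H1 _; rewrite -fE; lra.
Qed.

End Factorization.

(** * Adjoint pairs of maps *)

Section AdjointPair.
Variables (R : realType) (A : starAlgType R) (E F : innerModType A).
Variables (f : E -> F) (g : F -> E).
Hypothesis fg : forall x y, inner (f x) y = inner x (g y) :> A.

Lemma adjoint_pair_sym y x : inner (g y) x = inner y (f x) :> A.
Proof. by rewrite -star_inner -fg star_inner. Qed.

(** The form separates points, so the adjoint relation alone forces linearity. *)
Lemma adjoint_pair_morphism : module_morphism f.
Proof.
split=> [l x y|x a]; apply: inner_inj => z.
  by rewrite innerDr innerZr -!adjoint_pair_sym innerDr innerZr.
by rewrite inner_act -!adjoint_pair_sym inner_act.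
Qed.

End AdjointPair.

Lemma adjoint_pair_adjointable (R : realType) (A : starAlgType R)
    (E F : innerModType A) (f : E -> F) (g : F -> E) :
    (forall x y, inner (f x) y = inner x (g y) :> A) ->
  f \in @adjointable_map R A E F.
Proof.
move=> fg; apply/asboolP; split; first exact: adjoint_pair_morphism fg.
exists g; split=> //; apply: (@adjoint_pair_morphism _ _ _ _ _ f) => y x.
exact: adjoint_pair_sym.
Qed.

Lemma adjoint_pair_unitary (R : realType) (A : starAlgType R)
    (E F : innerModType A) (f : E -> F) (g : F -> E) :
    (forall x y, inner (f x) y = inner x (g y) :> A) ->
    cancel f g -> cancel g f ->
  unitarily_equivalent E F.
Proof.
move=> fg fK gK; have gf := adjoint_pair_sym fg.
exists (Adjointable (adjoint_pair_adjointable fg)).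
have -> : adj (Adjointable (adjoint_pair_adjointable fg)) =
    Adjointable (adjoint_pair_adjointable gf).
  exact: adj_uniq.
by split; apply: adjointable_inj => x /=; rewrite ?fK ?gK.
Qed.

(** * The embedding of E in M(E) and the transfer of unitaries *)

Section MultiplierModule.
Variables (R : realType) (A : locallyCstarType R).
Implicit Types E F : hilbertModType A.

Lemma inner_act_regular E (x : E) (a : regular_module A) (y : E) :
  inner (act x a) y = inner a (inner x y : regular_module A) :> A.
Proof. exact: inner_actl. Qed.

Definition act_map E (x : E) : adjointable (regular_module A) E :=
  Adjointable (adjoint_pair_adjointable (inner_act_regular x)).

Lemma adj_act_map E (x y : E) : adj (act_map x) y = inner x y.
Proof.
apply: (@inner_inj _ _ (regular_module A)) => a.
by rewrite -adjP; apply: inner_act_regular.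
Qed.

(** A may have no unit; after taking adjoints this is nondegeneracy of the form of A over itself. *)
Lemma smul_faithful (a b : A) : (forall c, a ** c = b ** c) -> a = b.
Proof.
move=> ab; rewrite -[a]starK -[b]starK; congr star.
apply: (@inner_inj _ _ (regular_module A)) => c.
rewrite /inner /= -!starM; congr star.
exact: ab.
Qed.

Lemma act_faithful E (x y : E) : (forall a : A, act x a = act y a) -> x = y.
Proof.
move=> xy; apply: inner_inj => z; apply: smul_faithful => a.
by rewrite -!inner_act xy.
Qed.

Lemma unitary_multiplier E F : unitarily_equivalent E F ->
  unitarily_equivalent (multiplier_module E) (multiplier_module F).
Proof.
move=> [U [UU' U'U]].
apply: (@adjoint_pair_unitary _ _ _ _
  (fun m : multiplier_module E => adjointable_comp U m : multiplier_module F)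
  (fun m : multiplier_module F =>
     adjointable_comp (adj U) m : multiplier_module E)).
- move=> m n; rewrite /inner /= adj_comp; exact/esym/adjointable_compA.
- by move=> m; rewrite adjointable_compA UU'; apply: adjointable_inj.
- by move=> m; rewrite adjointable_compA U'U; apply: adjointable_inj.
Qed.

(** For n = V(x), n^* n is left multiplication by <x, x>, so [adjointable_eq_act] applies. Stated
    for isometries, it serves both [V] and its adjoint. *)
Lemma multiplier_isometry_act E F
    (V : adjointable (multiplier_module E) (multiplier_module F)) :
    adjointable_comp (adj V) V = adjointable_id (multiplier_module E) ->
  forall x : E, exists z : F, V (act_map x) = act_map z.
Proof.
move=> VV x.
have VVx : inner (V (act_map x)) (V (act_map x)) =
    inner (act_map x : multiplier_module E) (act_map x) :> multiplier_algebra A.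
  by rewrite adjP -[adj V _]/(adjointable_comp (adj V) V _) VV.
have [|b|z zP] := @adjointable_eq_act _ _ _ (V (act_map x)) (inner x x).
- exact: star_inner.
- have := congr1 (fun T : adjointable _ _ => T (b : regular_module A)) VVx.
  by rewrite /inner /= => ->; rewrite adj_act_map inner_act.
- by exists z; apply: adjointable_inj => b; apply: zP.
Qed.

Lemma multiplier_unitary E F :
    unitarily_equivalent (multiplier_module E) (multiplier_module F) ->
  unitarily_equivalent E F.
Proof.
move=> [V [VV V'V]].
have /choice[f fP] := multiplier_isometry_act VV.
have /choice[g gP] : forall y : F, exists x : E, adj V (act_map y) = act_map x.
  by apply: multiplier_isometry_act; rewrite adjK.
have act_map_inj (G : hilbertModType A) : injective (@act_map G).
  move=> x y xy; apply: act_faithful => a.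
  exact: (congr1 (fun T : adjointable _ _ => T (a : regular_module A)) xy).
apply: (@adjoint_pair_unitary _ _ _ _ f g).
(* The adjoint relation for V equates two elements of M(A), namely left multiplication by <f x, y>
   and by <x, g y>. *)
- move=> x y.
  have := adjP V (act_map x) (act_map y); rewrite fP gP => H.
  apply: smul_faithful => a; rewrite -!inner_act.
  have := congr1 (fun T : adjointable _ _ => T (a : regular_module A)) H.
  by rewrite /inner /= !adj_act_map.
- move=> x; apply: act_map_inj.
  by rewrite -gP -fP -[adj V _]/(adjointable_comp (adj V) V _) VV.
- move=> y; apply: act_map_inj.
  by rewrite -fP -gP -[V _]/(adjointable_comp V (adj V) _) V'V.
Qed.

End MultiplierModule.

Theorem corollary4p2 (R : realType) (A : locallyCstarType R)
    (E F : hilbertModType A) :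
  unitarily_equivalent E F <->
  unitarily_equivalent (multiplier_module E) (multiplier_module F).
Proof. by split; [exact: unitary_multiplier|exact: multiplier_unitary]. Qed.
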